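(* For every constant $c>0$ there is a constant $C>0$ such that for every integer $n\ge 2$ there is an $m_0$ such that for all integers $m\ge m_0$ and all integers $k$ with $1\le k\le c\cdot\frac{\log m}{\log\log m}$ the following holds: for every $\alpha\in[0,1]$ with $\alpha>\frac{C}{\sqrt{\log\log m}}$, no $k$-query algorithm computes an $\alpha$-EFX allocation for every instance with $n$ agents and $m$ goods. (In asymptotic notation: for $k=O\big(\frac{\log m}{\log\log m}\big)$, no $k$-query algorithm can compute an allocation that achieves an EFX approximation of $\omega\big(\frac{1}{\sqrt{\log\log m}}\big)$.)
   Context: There is a set $N=\{1,\dots,n\}$ of $n\ge 2$ agents and a set $G$ of $m\ge n$ goods. Each agent $i$ has a valuation function $v_i:G\to\mathbb{R}_{\ge 0}$, extended additively to bundles: $v_i(X)=\sum_{g\in X}v_i(g)$ for $X\subseteq G$. An allocation is a tuple $(X_i)_{i\in N}$ of pairwise disjoint (possibly empty) bundles with $\bigcup_{i}X_i=G$. For $\alpha\in[0,1]$, an allocation is $\alpha$-EFX if for all agents $i\ne j$ with $X_j\neq\varnothing$ and every $g\in X_j$, $v_i(X_i)\ge\alpha\cdot v_i(X_j\setminus\{g\})$. A ranking (strict linear order) $\succ_i$ of $G$ is consistent with $v_i$ if $g\succ_i g'$ implies $v_i(g)\ge v_i(g')$. An instance consists of valuations together with rankings consistent with them. A $k$-query algorithm is a deterministic algorithm that receives as input the rankings $(\succ_i)_{i\in N}$, may (adaptively) make at most $k$ value queries per agent, where a value query names an agent $i$ and a good $g$ and returns $v_i(g)$, and finally outputs an allocation.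 *)

(* Defs.v *)
From mathcomp Require Import all_boot all_order all_algebra.
From mathcomp Require Import reals exp.

Set Implicit Arguments.
Unset Strict Implicit.
Unset Printing Implicit Defensive.

Import Order.TTheory GRing.Theory Num.Theory.
Local Open Scope ring_scope.

(* Agents are ['I_n] and goods are ['I_m]. *)

(* [prefers r g g'] means that [g] is ranked strictly above [g']. *)
Record ranking (m : nat) := Ranking {
  prefers :> rel 'I_m;
  prefers_irr : irreflexive prefers;
  prefers_trans : transitive prefers;
  prefers_connected : forall g g', g != g' -> prefers g g' || prefers g' g
}.

Definition consistent (R : realType) (m : nat)
    (r : ranking m) (v : 'I_m -> R) : Prop :=
  forall g g', r g g' -> v g' <= v g.

Record instance (R : realType) (n m : nat) := Instance {
  valuation : 'I_n -> 'I_m -> R;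
  rank_of : 'I_n -> ranking m;
  valuation_ge0 : forall i g, 0 <= valuation i g;
  rank_consistent : forall i, consistent (rank_of i) (valuation i)
}.

Record allocation (n m : nat) := Allocation {
  bundle :> 'I_n -> {set 'I_m};
  bundle_disjoint : forall i j, i != j -> [disjoint bundle i & bundle j];
  bundle_cover : \bigcup_i bundle i = [set: 'I_m]
}.

Definition bundle_value (R : realType) (m : nat)
    (v : 'I_m -> R) (X : {set 'I_m}) : R :=
  \sum_(g in X) v g.

Definition is_EFX (R : realType) (n m : nat) (alpha : R)
    (v : 'I_n -> 'I_m -> R) (X : allocation n m) : Prop :=
  forall i j, i != j -> X j != set0 -> forall g, g \in X j ->
    alpha * bundle_value (v i) (X j :\ g) <= bundle_value (v i) (X i).

(* The adaptive querying phase is a decision tree that branches over the real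
   answer to each query. Trees are well founded, so every run terminates, and
   there is no restriction on the computation made between queries. *)
Inductive query_tree (R : realType) (n m : nat) : Type :=
| Output of allocation n m
| Query of 'I_n & 'I_m & (R -> query_tree R n m).

Fixpoint run (R : realType) (n m : nat) (v : 'I_n -> 'I_m -> R)
    (t : query_tree R n m) : allocation n m :=
  match t with
  | Output X => X
  | Query i g next => run v (next (v i g))
  end.

(* Repeated queries for the same good are counted each time. *)
Fixpoint nb_queries (R : realType) (n m : nat) (v : 'I_n -> 'I_m -> R)
    (t : query_tree R n m) (a : 'I_n) : nat :=
  match t with
  | Output _ => 0%N
  | Query i g next => ((i == a) + nb_queries v (next (v i g)) a)%N
  end.

Definition algorithm (R : realType) (n m : nat) : Type :=
  ('I_n -> ranking m) -> query_tree R n m.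

(* The query budget is only imposed on runs over genuine instances. *)
Definition is_k_query (R : realType) (n m : nat) (k : nat)
    (A : algorithm R n m) : Prop :=
  forall (I : instance R n m) (a : 'I_n),
    (nb_queries (valuation I) (A (rank_of I)) a <= k)%N.

Definition computes_EFX (R : realType) (n m : nat) (alpha : R)
    (A : algorithm R n m) : Prop :=
  forall I : instance R n m,
    is_EFX alpha (valuation I) (run (valuation I) (A (rank_of I))).

(* Main.v *)
(* With n + 1 agents: all of them rank the goods by index, and every query is
   answered according to one fixed valuation v, in which the first n goods are
   worth 1 and the remaining ones follow a small multiple beta of the harmonic
   sequence.  Some agent i receives none of the first n goods.  Given the answers,
   each remaining good may be worth to i only as much as the next queried good;
   then each query contributes at most beta to the value of i's bundle, which is
   thus at most k beta.  Hence alpha <= k beta, unless every bundle containing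
   one of the first n goods is a singleton.  In that case i owns all the other
   goods, and another agent with valuation v, whose bundle is worth 1, values
   that of i at about beta log m, so that alpha beta log m = O(1).  Choosing
   beta = alpha / 2k gives alpha^2 = O(k / log m). *)

Require Import Defs.
From mathcomp Require Import all_boot all_order all_algebra.
From mathcomp Require Import reals exp.
From mathcomp Require Import ring lra.

Set Implicit Arguments.
Unset Strict Implicit.
Unset Printing Implicit Defensive.

Import Order.TTheory GRing.Theory Num.Theory.
Local Open Scope ring_scope.

(** * Runs and the answers they depend on *)

Fixpoint queried (R : realType) (n m : nat) (v : 'I_n -> 'I_m -> R)
    (t : query_tree R n m) (a : 'I_n) : seq 'I_m :=
  match t with
  | Output _ => [::]
  | Query i g next =>
      let s := queried v (next (v i g)) a in if i == a then g :: s else s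
  end.

Lemma size_queried (R : realType) (n m : nat) (v : 'I_n -> 'I_m -> R)
    (t : query_tree R n m) (a : 'I_n) :
  size (queried v t a) = nb_queries v t a.
Proof. by elim: t => [|i g next IH] //=; case: eqP => /=; rewrite IH. Qed.

(** Every query met on [v] gets the same answer from [w], so both runs follow the same branch. *)
Lemma run_congr (R : realType) (n m : nat) (v w : 'I_n -> 'I_m -> R)
    (t : query_tree R n m) :
  (forall a g, g \in queried v t a -> w a g = v a g) -> run w t = run v t.
Proof.
elim: t => [//|i g next IH] /= wE.
have -> : w i g = v i g by apply: wE; rewrite eqxx mem_head.
by apply: IH => a h hq; apply: wE; case: eqP => // _; rewrite inE hq orbT.
Qed.

(** * Goods ranked by index, and the lowest valuation fitting the answers *)

Lemma index_trans (m : nat) : transitive (fun g g' : 'I_m => (g < g')%N).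
Proof. by move=> y x z; apply: ltn_trans. Qed.

Lemma index_connected (m : nat) (g g' : 'I_m) :
  g != g' -> (g < g')%N || (g' < g)%N.
Proof. by rewrite -neq_ltn. Qed.

Definition index_ranking (m : nat) : ranking m :=
  Ranking (fun g : 'I_m => ltnn g) (@index_trans m) (@index_connected m).

Definition nonincr (R : realType) (m : nat) (v : 'I_m -> R) : Prop :=
  forall g g' : 'I_m, (g <= g')%N -> v g' <= v g.

Definition index_instance (R : realType) (n m : nat) (v : 'I_n -> 'I_m -> R)
    (v0 : forall i g, 0 <= v i g) (vN : forall i, nonincr (v i)) :
    instance R n m :=
  @Instance R n m v (fun=> index_ranking m) v0
    (fun i g g' gg' => vN i g g' (ltnW gg')).

(* The least nonnegative nonincreasing valuation that agrees with [v]
   on the first [n] goods and on [s]. *)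
Definition low (R : realType) (m n : nat) (v : 'I_m -> R) (s : seq 'I_m)
    (g : 'I_m) : R :=
  if (g < n)%N then v g else \big[Num.max/0]_(q <- s | (g <= q)%N) v q.

Section Low.
Variables (R : realType) (m n : nat) (v : 'I_m -> R) (s : seq 'I_m).
Hypotheses (v0 : forall g, 0 <= v g) (vN : nonincr v).

Lemma low_ge0 g : 0 <= low n v s g.
Proof. by rewrite /low; case: ifP => // _; apply: bigmax_ge_id. Qed.

Lemma low_nonincr : nonincr (low n v s).
Proof.
move=> g g' gg'; rewrite /low.
case: ltnP => [g'n|ng']; first by rewrite (leq_ltn_trans gg' g'n) vN.
case: ltnP => _; last by apply: sub_bigmax => q; apply: leq_trans.
by apply: bigmax_le => // q g'q; rewrite vN // (leq_trans gg').
Qed.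

Lemma low_mem g : g \in s -> low n v s g = v g.
Proof.
move=> gs; rewrite /low; case: ifP => // _; apply/eqP; rewrite eq_le.
apply/andP; split; first by apply: bigmax_le => // q; apply: vN.
by apply: le_bigmax_seq gs _; rewrite leqnn.
Qed.

(** A maximum of nonnegative terms is at most their sum. After exchanging sums, a query [q] is
    counted for at most [q.+1] goods, hence contributes at most [b]. *)
Lemma low_bundle_le (b : R) (X : {set 'I_m}) :
  0 <= b -> (forall g, g \in X -> (n <= g)%N) ->
  (forall g : 'I_m, (n <= g)%N -> g.+1%:R * v g <= b) ->
  bundle_value (low n v s) X <= (size s)%:R * b.
Proof.
move=> b0 Xn vb.
have lowE g : g \in X -> low n v s g <= \sum_(q <- s | (g <= q)%N) v q.
  move=> /Xn ng; rewrite /low ltnNge ng /=.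
  elim: s => [|q r IH]; first by rewrite !big_nil.
  rewrite !big_cons; case: ifP => // _.
  by rewrite ge_max lerDl sumr_ge0 //= (le_trans IH) // lerDr.
apply: le_trans (ler_sum _ lowE) _.
rewrite (exchange_big_dep (fun=> true)) //= -sum1_size natr_sum mulr_suml.
apply: ler_sum => q _; rewrite mul1r sumr_const -mulr_natl.
have [nq|qn] := leqP n q.
  apply: le_trans (vb _ nq); rewrite ler_wpM2r // ler_nat cardE -(size_map val).
  rewrite -(size_iota 0 q.+1) uniq_leq_size //.
    by rewrite (map_inj_uniq val_inj) enum_uniq.
  by move=> _ /mapP[g /[!mem_enum] /andP[_ gq] ->]; rewrite mem_iota.
(* A query [q < n] contributes nothing: all goods of [X] come after it. *)
rewrite eq_card0 ?mul0r // => g; apply/negbTE/negP => /andP[/Xn ng gq].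
by move: (leq_trans ng gq); rewrite leqNgt qn.
Qed.
End Low.

(** * The harmonic valuation *)

Definition harm (R : realType) (m n : nat) (beta : R) (g : 'I_m) : R :=
  if (g < n)%N then 1 else beta / g.+1%:R.

Lemma harm_ge0 (R : realType) (m n : nat) (beta : R) (g : 'I_m) :
  0 <= beta -> 0 <= harm n beta g.
Proof. by move=> b0; rewrite /harm; case: ifP => // _; rewrite divr_ge0. Qed.

Lemma harm_nonincr (R : realType) (m n : nat) (beta : R) :
  0 <= beta <= 1 -> nonincr (@harm R m n beta).
Proof.
move=> /andP[b0 b1] g g' gg'; rewrite /harm.
case: ltnP => [g'n|ng']; first by rewrite (leq_ltn_trans gg' g'n).
case: ltnP => _.
  by rewrite ler_pdivrMr ?ltr0n // mul1r (le_trans b1) // ler1n.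
by rewrite ler_wpM2l // lef_pV2 ?posrE ?ltr0n // ler_nat.
Qed.

(** The left side telescopes, and [ln (1 + x) <= x] at [x = 1 / (j + 1)] bounds each term. *)
Lemma ln_le_harmonic (R : realType) (a b : nat) : (a <= b)%N ->
  ln b.+1%:R - ln a.+1%:R <= \sum_(a <= j < b) j.+1%:R^-1 :> R.
Proof.
move=> ab; rewrite -(telescope_sumr (fun j => ln j.+1%:R)) //.
apply: ler_sum => j _; rewrite -ln_div ?posrE ?ltr0n //.
have -> : j.+2%:R / j.+1%:R = 1 + j.+1%:R^-1 :> R.
  by rewrite -addn1 natrD mulrDl divff ?pnatr_eq0 // mul1r.
by apply: le_ln1Dx; rewrite (lt_trans _ (_ : 0 < _)) ?invr_gt0 ?ltr0n ?ltrN10.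
Qed.

Lemma harm_bundle_ge (R : realType) (m n : nat) (beta : R) (X : {set 'I_m}) :
  0 <= beta -> (n < m)%N -> (forall g : 'I_m, (n < g)%N -> g \in X) ->
  beta * (ln m.+1%:R - ln n.+2%:R) <= bundle_value (harm n beta) X.
Proof.
move=> b0 nm nX.
apply: le_trans (ler_wpM2l b0 (ln_le_harmonic R nm)) _.
rewrite (big_nat_widenl _ 0) // big_mkord mulr_sumr.
rewrite /bundle_value [leRHS]big_mkcond [leLHS]big_mkcond /=.
apply: ler_sum => g _; case: ifP => [ng|_].
  by rewrite nX // /harm ltnNge ltnW.
by case: ifP => // _; apply: harm_ge0.
Qed.

(** * Owners of the first [n] goods, and the resulting bound *)

Lemma allocation_dichotomy (n m : nat) (X : allocation n.+1 m) :
  (0 < n <= m)%N ->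
  exists i, (forall g, g \in X i -> (n <= g)%N) /\
    ((exists j (t g : 'I_m),
        [/\ i != j, (t < n)%N, t \in X j, g \in X j & g != t]) \/
     (exists j (t : 'I_m), [/\ i != j, X j = [set t] &
        forall g : 'I_m, (n <= g)%N -> g \in X i])).
Proof.
move=> /andP[n0 nm].
have ownerP g : exists j, g \in X j.
  have : g \in \bigcup_j X j by rewrite bundle_cover inE.
  by case/bigcupP=> j _; exists j.
pose h (t : 'I_n) := xchoose (ownerP (widen_ord nm t)).
have hP t : widen_ord nm t \in X (h t) by apply: (xchooseP (ownerP _)).
have uniqX a b g : g \in X a -> g \in X b -> a = b.
  move=> ga gb; apply/eqP/negPn/negP => /(bundle_disjoint X).
  by move=> /pred0P /(_ g); rewrite /= ga gb.
have hE t j : widen_ord nm t \in X j -> h t = j by apply: uniqX (hP t).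
(* Pigeonhole: [n] goods have at most [n] owners among [n.+1] agents. *)
have [i iN] : exists i, i \notin codom h.
  apply/existsP; rewrite -negb_forall; apply/negP => /forallP hall.
  have : (#|'I_n.+1| <= #|codom h|)%N by apply/subset_leq_card/subsetP=> x _.
  by rewrite leqNgt card_ord ltnS (leq_trans (leq_image_card _ _)) ?card_ord.
have hi t : i != h t by apply: contraNneq iN => ->; apply: codom_f.
exists i; split=> [g gi|].
  rewrite leqNgt; apply/negP => gn.
  have gE : g = widen_ord nm (Ordinal gn) by apply: val_inj.
  by have := hi (Ordinal gn); rewrite (hE _ i) ?eqxx // -gE.
have [/existsP[t Xt]|/existsPn Xs] :=
  boolP [exists t, X (h t) != [set widen_ord nm t]].
  left; exists (h t), (widen_ord nm t).
  have [g] : exists g, (g \in X (h t)) && (g != widen_ord nm t).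
    apply/existsP; apply: contraNT Xt => /existsPn gN.
    rewrite eqEsubset sub1set hP andbT; apply/subsetP => g gX.
    by have := gN g; rewrite gX /= negbK inE.
  by case/andP=> gX gt; exists g; split; rewrite //= ltn_ord.
right; have {}Xs t : X (h t) = [set widen_ord nm t].
  by apply/eqP; rewrite -[_ == _]negbK Xs.
exists (h (Ordinal n0)), (widen_ord nm (Ordinal n0)); split=> // g ng.
(* Singleton bundles make the owners distinct, so by counting they are all the agents but [i], and
   the other goods go to [i]. *)
have h_inj : injective h.
  move=> t t' tt'; have := hP t'; rewrite -tt' Xs inE => /eqP/(congr1 val) E.
  exact/val_inj/esym.
have [j gj] := ownerP g; case: (eqVneq i j) => [->//|ij].
have hC : codom h =i predC1 i.
  apply/subset_cardP; first by rewrite card_codom // cardC1 !card_ord.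
  by apply/subsetP => _ /codomP[t ->]; rewrite inE eq_sym.
have : j \in codom h by rewrite hC inE eq_sym.
case/codomP=> t jE; move: gj; rewrite jE Xs inE => /eqP gE.
by move: ng; rewrite gE /= leqNgt ltn_ord.
Qed.

Lemma k_query_EFX_bound (R : realType) (n m k : nat) (alpha beta : R)
    (A : algorithm R n.+1 m) :
  (0 < n < m)%N -> 0 <= alpha -> 0 <= beta <= 1 ->
  is_k_query k A -> computes_EFX alpha A ->
  alpha <= k%:R * beta \/ alpha * (beta * (ln m.+1%:R - ln n.+2%:R)) <= 1.
Proof.
move=> /andP[n0 nm] a0 b01 Ak AX; have /andP[b0 b1] := b01.
pose v := @harm R m n beta.
have v0 g : 0 <= v g by apply: harm_ge0.
have vN : nonincr v by apply: harm_nonincr.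
pose I := @index_instance R n.+1 m (fun=> v) (fun=> v0) (fun=> vN).
have {Ak}Ak := Ak I; have IX := AX I; rewrite /= in Ak IX.
set t := A _ in Ak IX; set X := run _ _ in IX.
have [|i [Xi dich]] := @allocation_dichotomy n m X; first by rewrite n0 ltnW.
pose s := queried (fun=> v) t i.
case: dich => [[j [g [h [ij gn gX hX hg]]]]|[j [g [ij XjE iX]]]].
(* Lowering the valuation of [i] alone keeps all answers, so the same [X] must be EFX for [w]. *)
- left; pose w a := if a == i then low n v s else v.
  have w0 a x : 0 <= w a x by rewrite /w; case: ifP => // _; apply: low_ge0.
  have wN a : nonincr (w a).
    by rewrite /w; case: ifP => // _; apply: low_nonincr.
  have := AX (index_instance w0 wN); rewrite /= -/t.
  rewrite (@run_congr _ _ _ (fun=> v)) -/X; last first.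
    by move=> a x; rewrite /w; case: eqP => // -> xs; apply: low_mem.
  have Xj0 : X j != set0 by apply/set0Pn; exists g.
  move=> /(_ i j ij Xj0 h hX) H.
  have vg : v g <= bundle_value (w i) (X j :\ h).
    rewrite /bundle_value (big_setD1 g) /=; last by rewrite !inE eq_sym hg.
    by rewrite {1}/w eqxx /low gn lerDl sumr_ge0 //.
  have vX : bundle_value (w i) (X i) <= k%:R * beta.
    rewrite /w eqxx.
    apply: le_trans (@low_bundle_le _ _ _ v s v0 beta _ b0 Xi _) _.
      move=> x nx; rewrite /v /harm ltnNge nx /=.
      by rewrite mulrC divfK ?pnatr_eq0.
    by rewrite ler_wpM2r // ler_nat size_queried.
  have v1 : 1 <= bundle_value (w i) (X j :\ h).
    by move: vg; rewrite /v /harm gn.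
  by rewrite (le_trans _ vX) // (le_trans _ H) // ler_peMr.
- right; have nX : Ordinal nm \in X i by apply: iX.
  have X0 : X i != set0 by apply/set0Pn; exists (Ordinal nm).
  have := IX j i; rewrite eq_sym => /(_ ij X0 _ nX) H.
  have v1 : v g <= 1.
    rewrite /v /harm; case: ltnP => // _.
    by rewrite ler_pdivrMr ?ltr0n // mul1r (le_trans b1) // ler1n.
  rewrite XjE {2}/bundle_value big_set1 in H.
  apply: le_trans v1; apply: le_trans H; rewrite ler_wpM2l //.
  apply: harm_bundle_ge => // x nx; rewrite !inE iX ?(ltnW nx) // andbT.
  by apply: contraTneq nx => ->; rewrite ltnn.
Qed.

Theorem corollary3p4 (R : realType) (c : R) :
  0 < c ->
  exists C : R, 0 < C /\
    forall n : nat, (2 <= n)%N ->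
    exists m0 : nat, forall m : nat, (m0 <= m)%N -> (n <= m)%N ->
    forall k : nat, (1 <= k)%N ->
      k%:R <= c * (ln m%:R / ln (ln m%:R)) ->
    forall alpha : R, 0 <= alpha <= 1 ->
      C / Num.sqrt (ln (ln m%:R)) < alpha ->
    ~ exists A : algorithm R n m, is_k_query k A /\ computes_EFX alpha A.
Proof.
(* The summand 1 ensures that the square of this constant exceeds [4 * c]. *)
move=> c0; exists (1 + 4 * c); split; first lra.
(* This threshold gives [ln n.+2 <= L / 2], so at least half of [L] survives the subtraction. *)
case=> [|n] // n1; exists (n.+2 ^ 2)%N => m nm2 nm k k1 kc.
move=> alpha a01 Ca [A [Ak AX]].
have /andP[a0 a1] := a01.
have m1 : (1 < m)%N := leq_trans n1 nm.
set L := ln m%:R in kc Ca *; set LL := ln L in kc Ca.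
have k1R : 1 <= k%:R :> R by rewrite ler1n.
have L0 : 0 < L by rewrite ln_gt0 // ltr1n.
(* Otherwise the upper bound on [k] would be nonpositive, also at [LL = 0], where the inverse is
   0. *)
have LL0 : 0 < LL.
  rewrite -invr_gt0 -(pmulr_rgt0 _ L0) -(pmulr_rgt0 _ c0).
  by apply: lt_le_trans kc; rewrite ltr0n.
have sLL : 0 < Num.sqrt LL by rewrite sqrtr_gt0.
have a_gt0 : 0 < alpha by apply: lt_trans Ca; rewrite divr_gt0 //; lra.
have kLL : k%:R * LL <= c * L.
  by rewrite -ler_pdivlMr // -mulrA.
have aLL : 4 * c < alpha ^+ 2 * LL.
  rewrite ltr_pdivrMr // in Ca.
  rewrite -[LL]sqr_sqrtr ?ltW // -exprMn.
  have : 0 <= (alpha * Num.sqrt LL) by rewrite mulr_ge0 ?ltW.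
  nra.
have k_gt0 : 0 < k%:R :> R by lra.
(* Then [k * beta = alpha / 2 < alpha], which excludes the first alternative. *)
pose beta := alpha / (2 * k%:R).
have bE : beta * (2 * k%:R) = alpha by rewrite divfK // lt0r_neq0 // mulr_gt0.
have b_gt0 : 0 < beta by rewrite divr_gt0 // mulr_gt0.
have b01 : 0 <= beta <= 1 by rewrite ltW //=; nra.
have nm' : (0 < n < m)%N by rewrite -ltnS n1.
have [|] := k_query_EFX_bound nm' a0 b01 Ak AX; first by nra.
have nL : 2 * ln n.+2%:R <= L.
  rewrite mulr_natl -lnXn ?ltr0n // ler_ln ?posrE.
  - by rewrite -natrX ler_nat.
  - by rewrite exprn_gt0 ?ltr0n.
  by rewrite ltr0n ltnW.
have mL : L <= ln m.+1%:R.
  by rewrite ler_ln ?posrE ?ltr0n ?(ltnW m1) // ler_nat.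
set M := _ - _ => abM.
have LM : L <= 2 * M by rewrite /M; lra.
have : alpha * beta * L <= 2.
  have ab : 0 <= alpha * beta by rewrite mulr_ge0 // ltW.
  have := ler_wpM2l ab LM; lra.
move=> abL.
have aL : alpha ^+ 2 * L <= 4 * k%:R.
  have -> : alpha ^+ 2 * L = alpha * beta * L * (2 * k%:R) by rewrite -bE; ring.
  by have := ler_wpM2r (ltW k_gt0) abL; lra.
(* Contradiction: [alpha^2 * L * LL <= 4 * k * LL <= 4 * c * L < alpha^2 * LL * L]. *)
have := ler_wpM2r (ltW LL0) aL.
have := ltr_pM2r L0 (4 * c) (alpha ^+ 2 * LL).
rewrite aLL => E F; lra.
Qed.
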